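(* Let $G=S_\infty$, the group of all permutations of $\omega$ with the topology of pointwise convergence. There exist $x\neq y$ in $K(S(G))$ such that for every minimal subflow $M\subseteq S(G)$ and every retraction $\phi:S(G)\to M$, we have $\phi(x)=\phi(y)$.
   Context: $S(G)$ is the Samuel compactification of $G$ with respect to its left uniformity; it is a $G$-flow (compact Hausdorff space with continuous right $G$-action extending right multiplication) and the greatest $G$-ambit with distinguished point $1_G$. It carries a compact left-topological semigroup structure: for $x\in S(G)$, $\lambda_x:S(G)\to\overline{xG}$ is the unique continuous $G$-equivariant map with $\lambda_x(1_G)=x$, and $xy:=\lambda_x(y)$. $K(S(G))$ denotes the smallest two-sided ideal of this semigroup. A subflow is a nonempty closed $G$-invariant subset; it is minimal if it contains no proper subflow. A retraction onto a minimal subflow $M$ is a continuous $G$-equivariant map $\phi:S(G)\to M$ with $\phi|_M=\mathrm{id}_M$. *)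

(* Defs.v *)
From mathcomp Require Import all_boot all_classical all_reals all_analysis.
Set Implicit Arguments. Unset Strict Implicit. Unset Printing Implicit Defensive.
Local Open Scope classical_set_scope.

Definition Sinf := {f : nat -> nat | bijective f}.

Definition sinf_id : Sinf := exist _ id (Bijective (g := id) (fun _ => erefl) (fun _ => erefl)).

Definition sinf_mul (g h : Sinf) : Sinf :=
  exist _ (proj1_sig g \o proj1_sig h) (bij_comp (proj2_sig g) (proj2_sig h)).

(* A continuous right action of S_infinity (topology of pointwise convergence,
   whose basic neighbourhoods of g are {h | h i = g i for all i < n}) on Y. *)
Definition is_flow (Y : topologicalType) (a : Y -> Sinf -> Y) : Prop :=
  [/\ forall y, a y sinf_id = y,
      forall y g h, a (a y g) h = a y (sinf_mul g h) &
      forall y g (U : set Y), nbhs (a y g) U ->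
        exists2 V : set Y, nbhs y V &
          exists n : nat, forall y' h, V y' ->
            (forall i, (i < n)%N -> proj1_sig h i = proj1_sig g i) -> U (a y' h)].

Definition G_flow (Y : topologicalType) (a : Y -> Sinf -> Y) : Prop :=
  [/\ compact [set: Y], hausdorff_space Y & is_flow a].

Definition G_ambit (Y : topologicalType) (a : Y -> Sinf -> Y) (y0 : Y) : Prop :=
  G_flow a /\ closure (range (a y0)) = [set: Y].

Definition equivariant (X Y : topologicalType) (a : X -> Sinf -> X) (b : Y -> Sinf -> Y)
  (f : X -> Y) : Prop := forall x g, f (a x g) = b (f x) g.

(* (X, a, x0) is the greatest G-ambit, i.e. the Samuel compactification S(G)
   with distinguished point 1_G = x0. *)
Definition greatest_ambit (X : topologicalType) (a : X -> Sinf -> X) (x0 : X) : Prop :=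
  G_ambit a x0 /\
  forall (Y : topologicalType) (b : Y -> Sinf -> Y) (y0 : Y), G_ambit b y0 ->
    exists f : X -> Y, [/\ continuous f, equivariant a b f & f x0 = y0].

(* mul is the semigroup operation: mul x = lambda_x, the continuous equivariant
   map with lambda_x(x0) = x (unique since the orbit of x0 is dense). *)
Definition samuel_mul (X : topologicalType) (a : X -> Sinf -> X) (x0 : X)
  (mul : X -> X -> X) : Prop :=
  forall x, [/\ continuous (mul x), equivariant a a (mul x) & mul x x0 = x].

Definition two_sided_ideal (X : Type) (mul : X -> X -> X) (I : set X) : Prop :=
  I !=set0 /\ forall x y, I x -> I (mul x y) /\ I (mul y x).

Definition in_K (X : Type) (mul : X -> X -> X) (z : X) : Prop :=
  forall I, two_sided_ideal mul I -> I z.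

Definition subflow (X : topologicalType) (a : X -> Sinf -> X) (M : set X) : Prop :=
  [/\ M !=set0, closed M & forall x g, M x -> M (a x g)].

Definition minimal_subflow (X : topologicalType) (a : X -> Sinf -> X) (M : set X) : Prop :=
  subflow a M /\ forall N, subflow a N -> N `<=` M -> N = M.

Definition retraction (X : topologicalType) (a : X -> Sinf -> X) (M : set X)
  (phi : X -> X) : Prop :=
  [/\ continuous phi, equivariant a a phi, (forall x, M (phi x)) &
      forall x, M x -> phi x = x].

(* Main.v *)
From HB Require Import structures.
Require Import Defs.
From mathcomp Require Import all_boot all_classical all_reals all_analysis.
Local Open Scope classical_set_scope.
Set Implicit Arguments. Unset Strict Implicit. Unset Printing Implicit Defensive.

(* A retraction onto M is left multiplication by a point of M. Given an
   ultrafilter p on omega, Ramsey-type tensor powers of p yield an equivariant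
   continuous map e from the flow LO of linear orders of omega to S(G), with
   e(r) w = e(r w); its image is a minimal flow, so every point of a minimal M
   has the form v e(r). Hence phi(x) = v e(r x), and phi identifies any two
   points acting in the same way on LO, i.e. with the same behaviour on pairs
   towards every linear order. Code pairs of integers by integers: for p-generic
   s0 < s1 < s2 < s3, no linear order of omega distinguishes the pair of codes
   (s0 s1, s2 s3) from (s0 s2, s1 s3), since otherwise it would have a cycle,
   but the two configurations differ; they give the points x and y. *)

Local Notation "g @@ i" := (proj1_sig g i) (at level 10).

Lemma sinf_ext (g h : Sinf) : proj1_sig g =1 proj1_sig h -> g = h.
Proof.
case: g h => [g gP] [h hP] /= /funext gh; case: _ / gh in hP *.
by congr exist; exact: Prop_irrelevance.
Qed.

Lemma sinf_inv (g : Sinf) : exists h : Sinf,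
  cancel (proj1_sig g) (proj1_sig h) /\ cancel (proj1_sig h) (proj1_sig g).
Proof.
case: g => g [h gh hg].
by exists (exist _ h (Bijective hg gh)).
Qed.

(** * Orbit closures as ambits *)

Section Flow.
Variables (Y : topologicalType) (b : Y -> Sinf -> Y).

Lemma flow_continuous g : is_flow b -> continuous (b ^~ g).
Proof.
move=> [_ _ bC] y U /bC[V nV [n VU]].
by apply: filterS nV => y' Vy'; exact: VU.
Qed.

Lemma flow_invariant_closure g y0 y : is_flow b ->
  closure (range (b y0)) y -> closure (range (b y0)) (b y g).
Proof.
move=> bF cly U /(flow_continuous bF) nU.
have [_ [[h _ <-] Uh]] := cly _ nU.
by case: bF => _ bM _; exists (b (b y0 h) g); split=> //; exists (sinf_mul h g).
Qed.

End Flow.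

Section OrbitClosure.
Variables (Y : topologicalType) (b : Y -> Sinf -> Y) (y0 : Y).
Hypothesis bG : G_flow b.
Let C := closure (range (b y0)).

Let bF : is_flow b. Proof. by case: bG. Qed.

Let C0 : y0 \in C.
Proof.
rewrite inE; apply: subset_closure; exists sinf_id => //.
by case: bF.
Qed.

Definition orbit_closure : Type := set_type C.
HB.instance Definition _ := Topological.on orbit_closure.

Definition orbit_base : orbit_closure := exist _ y0 C0.

Definition orbit_act (c : orbit_closure) (g : Sinf) : orbit_closure :=
  exist _ (b (sval c) g)
    (mem_set (flow_invariant_closure bF (set_mem (svalP c)))).

Lemma nbhs_orbit_closure (c : orbit_closure) U :
  nbhs c U <-> exists2 V, nbhs (sval c) V & sval @^-1` V `<=` U.
Proof.
split=> [[_ /= [[W oW <-] Wc WU]]|[V]].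
  by exists W => //; exact: open_nbhs_nbhs.
rewrite nbhsE => -[W [oW Wc] WV] VU.
exists (sval @^-1` W); split=> /=; first by exists W.
  exact: Wc.
by move=> d /WV; exact: VU.
Qed.

Lemma sval_orbit_closure_continuous : continuous (sval : orbit_closure -> Y).
Proof. by move=> c U nU; apply/nbhs_orbit_closure; exists U. Qed.

Lemma orbit_closure_ambit : G_ambit orbit_act orbit_base.
Proof.
case: bG => cY hY _; split; first split.
- rewrite compact_ultra => F FU _.
  have : (sval @ F) [set: Y] by exact: filterT.
  move: (cY); move/(_ (sval @ F) _) => /[apply] -[y [_ cly]].
  (* The cluster point found in [Y] lies in the closed set [C], hence lifts to the subspace. *)
  have Cy : C y.
    apply: closed_closure => U nU; have /cly/(_ nU) [z []] : (sval @ F) C.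
      by apply: (@filterE _ F) => c; exact: (set_mem (svalP c)).
    by exists z.
  rewrite -ultra_cvg_clusterE.
  exists (exist _ y (mem_set Cy) : orbit_closure); split => //= A U FA.
  move=> /nbhs_orbit_closure /= [V nV VU].
  have /cly/(_ nV) [_ [[c Ac <-] Vc]] : (sval @ F) (sval @` A).
    by apply: (@filterS _ F) FA => c Ac; exists c.
  by exists c; split=> //; exact: VU.
- move=> c d cl; apply: eq_sig_hprop => [? ? ?|]; first exact: Prop_irrelevance.
  apply: hY => A B nA nB.
  have [e [Ae Be]] := cl _ _ (sval_orbit_closure_continuous nA)
     (sval_orbit_closure_continuous nB).
  by exists (sval e).
- case: bF => b1 bM bC; split.
  + move=> c; apply: eq_sig_hprop => [? ? ?|]; first exact: Prop_irrelevance.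
    exact: b1.
  + move=> c g h; apply: eq_sig_hprop => [? ? ?|]; first exact: Prop_irrelevance.
    exact: bM.
  + move=> c g U /nbhs_orbit_closure /= [W /bC[V nV [n VW]] WU].
    exists (sval @^-1` V); first exact: sval_orbit_closure_continuous.
    by exists n => d h Vd hg; apply: WU; exact: VW.
- apply/seteqP; split=> // c _ U /nbhs_orbit_closure [V nV VU].
  have [_ [[g _ <-] Vg]] := set_mem (svalP c) _ nV.
  by exists (orbit_act orbit_base g); split; [exists g|exact: VU].
Qed.

End OrbitClosure.

(** The universal property concerns ambits only; applied to the orbit closure of [y0], it extends to
    every flow and base point. *)
Lemma greatest_ambit_flow (X : topologicalType) (a : X -> Sinf -> X) (x0 : X)
    (Y : topologicalType) (b : Y -> Sinf -> Y) (y0 : Y) :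
  greatest_ambit a x0 -> G_flow b ->
  exists f : X -> Y, [/\ continuous f, equivariant a b f & f x0 = y0].
Proof.
move=> [_ aU] bG; have [f [fC fE fx0]] := aU _ _ _ (orbit_closure_ambit y0 bG).
exists (sval \o f); split=> [x|x g|].
- by apply: continuous_comp; [exact: fC|exact: sval_orbit_closure_continuous].
- by rewrite /= fE.
- by rewrite /= fx0.
Qed.

(** * The flow of binary relations *)

Section RelationFlow.

(** All relations are kept, not only linear orders: compactness is then Tychonoff, and linearity is
    recovered later by density. *)
Definition relspace : Type := {ptws (nat * nat)%type -> bool}.
HB.instance Definition _ := Topological.on relspace.

Definition rel_act (r : relspace) (g : Sinf) : relspace :=
  fun ij => r (g @@ ij.1, g @@ ij.2).

Definition agree_on (s : seq (nat * nat)) (r r' : relspace) : Prop :=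
  forall ij, ij \in s -> r' ij = r ij.

Lemma nbhs_relspaceE (r : relspace) (U : set relspace) :
  nbhs r U <-> exists s : seq (nat * nat), agree_on s r `<=` U.
Proof.
split=> [nU|[s sU]].
  pose F : set_system relspace :=
    filter_from setT (fun s : seq (nat * nat) => agree_on s r).
  have FF : Filter F.
    apply: filter_from_filter; first by exists [::].
    move=> s t _ _; exists (s ++ t) => // r' rr'; split=> i si; apply: rr';
      by rewrite mem_cat si ?orbT.
  have : F --> r.
    apply/cvg_sup => i V [_ /= [[W oW <-] Wr WV]].
    by exists [:: i] => // r' /(_ i (mem_head _ _)) rr'; apply: WV => /=; rewrite rr'.
  by move=> /(_ _ nU)[s _ sU]; exists s.
apply: filterS sU _; elim: s => [|i s IH]; first exact: filterE.
have ni : nbhs r [set r' : relspace | r' i = r i].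
  exact: (@proj_continuous _ (fun=> bool) i r [set c | c = r i]).
apply: filterS (filterI ni IH) => r' [ri rs] j.
by rewrite inE => /predU1P[->//|]; exact: rs.
Qed.

Lemma relspace_flow : G_flow rel_act.
Proof.
split.
- have := @tychonoff _ (fun _ : nat * nat => bool) (fun=> setT)
    (fun=> bool_compact).
  by congr compact; apply/seteqP; split.
- exact: (@hausdorff_product _ (fun _ : nat * nat => bool)
    (fun=> discrete_hausdorff)).
- split=> // [r|r g U /nbhs_relspaceE[s sU]].
    by apply: (@funext (nat * nat) bool) => -[].
  pose t := [seq (g @@ ij.1, g @@ ij.2) | ij <- s].
  exists (agree_on t r); first by apply/nbhs_relspaceE; exists t.
  (* This bound exceeds every integer occurring in [s]. *)
  exists (\max_(ij <- s) (maxn ij.1 ij.2).+1) => r' h rr' hg; apply: sU => ij sij.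
  rewrite /rel_act.
  have : (maxn ij.1 ij.2).+1 <= \max_(ij <- s) (maxn ij.1 ij.2).+1.
    by rewrite (big_rem _ sij) /= leq_maxl.
  rewrite gtn_max => /andP[lt1 lt2]; rewrite !hg//.
  by apply: rr'; apply: map_f.
Qed.

End RelationFlow.

Lemma greatest_ambit_rel (X : topologicalType) (a : X -> Sinf -> X) (x0 : X)
    (r : rel nat) : greatest_ambit a x0 ->
  exists pi : X -> rel nat,
    [/\ forall x i j, \forall x' \near x, pi x' i j = pi x i j,
        forall x g i j, pi (a x g) i j = pi x (g @@ i) (g @@ j)
      & pi x0 = r].
Proof.
move=> /greatest_ambit_flow /(_ relspace_flow).
move=> /(_ (fun ij => r ij.1 ij.2))[f [fC fE fx0]].
exists (fun x i j => f x (i, j)); split=> [x i j|x g i j|].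
- apply: (fC x [set r' : relspace | r' (i, j) = f x (i, j)]).
  by apply/nbhs_relspaceE; exists [:: (i, j)] => r' /(_ _ (mem_head _ _)).
- by rewrite fE.
- by apply/funext => i; apply/funext => j; rewrite fx0.
Qed.

(** * Convergence along filters on the group *)

Section FlowLimits.
Variables (X : topologicalType) (a : X -> Sinf -> X).
Hypothesis aG : G_flow a.

Lemma closed_nbhs_sub (z : X) W : nbhs z W ->
  exists C, [/\ nbhs z C, closed C & C `<=` W].
Proof.
case: aG => cX hX _ nW.
have [C nC CW] := compact_regular hX cX filterT nW.
exists (closure C); split=> //; last exact: closed_closure.
by apply: filterS nC; exact: subset_closure.
Qed.

(* By compactness, close elements of the group displace points of C uniformly
   little: this is uniform continuity of orbit maps for the left uniformity. *)
Lemma flow_uniform (C W : set X) : closed C -> (forall y, C y -> nbhs y W) ->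
  exists n, forall y h, C y -> (forall i, i < n -> h @@ i = i) -> W (a y h).
Proof.
case: aG => cX _ [a1 _ aC] clC CW.
have /compact_near_coveringP cC := subclosed_compact clC cX (@subsetT _ C).
have [|n _ Pn] := cC nat \oo
    (fun n y => forall h, (forall i, i < n -> h @@ i = i) -> W (a y h)) _.
  move=> y Cy; have : nbhs (a y sinf_id) W by rewrite a1; exact: CW.
  move=> /aC[V nV [n VW]]; exists (V, [set m | n <= m]) => /=.
    by split=> //; exists n.
  move=> [y' m] /= [Vy' nm] h hm; apply: VW => // i i_n.
  by apply: hm; exact: leq_trans nm.
by exists n => y h Cy hn; exact: (Pn n (leqnn n)).
Qed.

(** Such an [A] is a union of left cosets of the pointwise stabiliser of the integers below [n]. *)
Definition coset_invariant n (A : set Sinf) : Prop :=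
  forall g h, (forall i, i < n -> g @@ i = h @@ i) -> A g -> A h.

(** Orbit maps are uniformly continuous, so a filter that decides the coset-invariant sets converges
    to any of its cluster points, even if it is not an ultrafilter. *)
Lemma flow_cvg (F : set_system Sinf) (y : X) : ProperFilter F ->
  (forall n A, coset_invariant n A -> F A \/ F (~` A)) ->
  exists z : X, a y @ F --> z.
Proof.
case: (aG) => cX _ [a1 aM _] FF FU.
have [z [_ clz]] : setT `&` cluster (a y @ F) !=set0 by apply: cX; exact: filterT.
exists z => W /nbhs_interior nW.
have [C [nC clC CW]] := closed_nbhs_sub nW.
have [n nCW] := flow_uniform clC CW.
pose A : set Sinf :=
  [set g | exists2 h, C (a y h) & forall i, i < n -> h @@ i = g @@ i].
have AW : A `<=` [set g | W (a y g)].
  move=> g [h Ch hg]; have [k [hk kh]] := sinf_inv h.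
  (* The factor [sinf_mul k g], with [k] inverse to [h], fixes every integer below [n]. *)
  have -> : g = sinf_mul h (sinf_mul k g) by apply: sinf_ext => i /=; rewrite kh.
  rewrite /= -aM; apply: nCW => // i i_n /=.
  by rewrite -hg// hk.
have [|FA|FA] := FU n A.
- move=> g h gh [k Ck kg]; exists k => // i i_n.
  by rewrite kg// gh.
- exact: (@filterS _ F _ _ _ AW).
- have FC : (a y @ F) (~` C).
    by apply: (@filterS _ F) FA => g; apply: contra_not => Cg; exists g.
  by have [x []] := clz _ _ FC nC.
Qed.

End FlowLimits.

(** * Coherent types and filters on the permutation group *)

Lemma sinf_extension (L s : seq nat) : uniq L -> uniq s -> size L = size s ->
  exists g : Sinf, [seq g @@ i | i <- L] = s.
Proof.
elim: L s => [|x L IH] [|y s] //=; first by exists sinf_id.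
move=> /andP[xL uL] /andP[ys us] [sLs]; have [g gL] := IH s uL us sLs.
pose z := g @@ x.
(* Swapping [y] and [z] corrects the value at [x] and moves none of the values already taken on
   [L]. *)
pose t := fun k => if k == y then z else if k == z then y else k.
have tK : involutive t.
  move=> k; rewrite /t; have [->|ky] := eqVneq k y.
    by rewrite eqxx; case: eqP.
  have [->|kz] := eqVneq k z; first by rewrite eqxx.
  by rewrite (negPf ky) (negPf kz).
exists (sinf_mul (exist _ t (Bijective tK tK)) g) => /=.
congr cons; first by rewrite /t -/z eqxx; case: eqP.
rewrite -gL; apply/eq_in_map => i iL /=; rewrite /t.
have -> : (g @@ i == y) = false.
  by apply/negbTE; apply: contraNneq ys => <-; rewrite -gL map_f.
have -> : (g @@ i == z) = false.
  apply/negbTE; apply: contraNneq xL => giz.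
  by have /bij_inj/(_ _ _ giz) <- := proj2_sig g.
by [].
Qed.

Definition strict_linear (r : rel nat) : Prop :=
  [/\ irreflexive r, transitive r & forall i j, i != j -> r i j || r j i].

Lemma strict_linear_sorted (r : rel nat) (s : seq nat) : strict_linear r ->
  exists2 L, sorted r L & L =i s.
Proof.
move=> [rirr rtr rtot]; pose r' := [rel x y | (x == y) || r x y].
have r'tr : transitive r'.
  move=> y x z /= /predU1P[->//|xy] /predU1P[<-|yz]; first by rewrite xy orbT.
  by rewrite (rtr _ _ _ xy yz) orbT.
have r'tot : total r'.
  move=> x y /=; have [->|xy] := eqVneq x y; first by [].
  by case/orP: (rtot _ _ xy) => ->; rewrite ?orbT.
exists (sort r' (undup s)); last by move=> x; rewrite mem_sort mem_undup.
have : pairwise r' (sort r' (undup s)) && pairwise [rel x y | x != y] (sort r' (undup s)).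
  rewrite -uniq_pairwise sort_uniq undup_uniq andbT.
  by rewrite -sorted_pairwise// sort_sorted.
rewrite -pairwise_relI => /sub_pairwise; rewrite sorted_pairwise//; apply.
by move=> x y /= /andP[/predU1P[->|//]]; rewrite eqxx.
Qed.

(* tau n is an ultrafilter on n-tuples, to be thought of as the joint type of
   an indiscernible sequence of n elements, listed in the order of the index. *)
Record coherent_type (tau : nat -> set_system (seq nat)) : Prop := CoherentType {
  coherent_proper : forall n, ProperFilter (tau n);
  coherent_ultra : forall n B, tau n B \/ tau n (~` B);
  coherent_uniq : forall n, tau n [set s | size s = n /\ uniq s];
  coherent_mask : forall m B,
    tau (count id m) B -> tau (size m) [set s | B (mask m s)] }.

(* Basic sets say that the tuple of values of g on a finite set, listed in
   increasing order for r, belongs to a set of tau. *)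
Definition order_filter (tau : nat -> set_system (seq nat)) (r : rel nat) :
    set_system Sinf :=
  fun A => exists2 L, sorted r L &
    tau (size L) [set s | forall g : Sinf, [seq g @@ i | i <- L] = s -> A g].

Section OrderFilter.
Variables (tau : nat -> set_system (seq nat)) (r : rel nat).
Hypotheses (tauC : coherent_type tau) (rL : strict_linear r).
#[local] Instance tau_proper n : ProperFilter (tau n).
Proof. exact: coherent_proper. Qed.

(** Both lists being sorted for [r], the smaller is a sublist of the larger, so coherence under
    masks applies. *)
Lemma order_filter_sub (L L' : seq nat) (A : set Sinf) :
  sorted r L -> sorted r L' -> {subset L <= L'} ->
  tau (size L) [set s | forall g : Sinf, [seq g @@ i | i <- L] = s -> A g] ->
  tau (size L') [set s | forall g : Sinf, [seq g @@ i | i <- L'] = s -> A g].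
Proof.
case: rL => rirr rtr _ sL sL' LL'; pose m := map (mem L) L'.
have -> : L = mask m L'.
  rewrite -filter_mask; apply: (irr_sorted_eq rtr rirr) => //.
    exact: sorted_filter.
  by move=> x; rewrite mem_filter /= andb_idr//; exact: LL'.
rewrite size_mask ?size_map// => /(coherent_mask tauC).
rewrite size_map; apply: filterS => s /= sA g gs; apply: sA.
by rewrite map_mask gs.
Qed.

(** Almost every tuple has distinct entries, hence is the list of values of some permutation; this
    gives nonemptiness. For intersections, both lists embed in one sorted list. *)
Lemma order_filter_proper : ProperFilter (order_filter tau r).
Proof.
case: (rL) => rirr rtr _.
split; [|split].
- move=> [L sL] tL.
  have [s [/= [ss us] nos]] := filter_ex (filterI (coherent_uniq tauC _) tL).
  have [g gL] := sinf_extension (sorted_uniq rtr rirr sL) us (esym ss).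
  exact: nos gL.
- by exists [::] => //; apply: filterE.
- move=> A B [L sL tA] [L' sL' tB].
  have [M sM ML] := strict_linear_sorted (L ++ L') rL.
  exists M => //; have tA' := order_filter_sub sL sM _ tA.
  have tB' := order_filter_sub sL' sM _ tB.
  apply: filterS2 (tA' _) (tB' _) => [s sA sB g gs|i iL|i iL].
  + by split; [exact: sA|exact: sB].
  + by rewrite ML mem_cat iL.
  + by rewrite ML mem_cat iL orbT.
- move=> A B AB [L sL tA]; exists L => //.
  by apply: filterS tA => s sA g gs; apply/AB/sA.
Qed.

(** Membership in [A] depends only on the values on a sorted list of the integers below [n]. *)
Lemma order_filter_ultra n A : coset_invariant n A ->
  order_filter tau r A \/ order_filter tau r (~` A).
Proof.
move=> Ainv; have [L sL Ln] := strict_linear_sorted (iota 0 n) rL.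
have [tA|tA] := coherent_ultra tauC (size L)
    [set s | forall g : Sinf, [seq g @@ i | i <- L] = s -> A g].
  by left; exists L.
right; exists L => //; apply: filterS tA => s /= + g gs Ag; apply.
move=> h hs; apply: Ainv Ag => i i_n.
have iL : i \in L by rewrite Ln mem_iota.
by move: hs; rewrite -gs => /eq_in_map -> .
Qed.

End OrderFilter.

(** * Two coherent types on coded pairs *)

Section TensorPower.
Variable p : set_system nat.
Hypotheses (pU : UltraFilter p) (poo : \oo `<=` p).

(** Iterated Fubini product: the head is quantified first, so each entry is generic over the earlier
    ones, hence larger since [p] is nonprincipal. *)
Fixpoint tensor_power (n : nat) : set_system (seq nat) := fun B =>
  if n is n'.+1 then p [set x | tensor_power n' [set s | B (x :: s)]]
  else B [::].

Lemma tensor_powerS n (B C : set (seq nat)) : B `<=` C ->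
  tensor_power n B -> tensor_power n C.
Proof.
elim: n B C => [|n IH] B C BC /=; first exact: BC.
by apply: filterS => x; apply: IH => s; exact: BC.
Qed.

#[local] Instance tensor_power_proper n : ProperFilter (tensor_power n).
Proof.
split; [|split].
- elim: n => [//|n IH] /= p0; apply: (@filter_not_empty _ p).
  by apply: filterS p0 => x; exact: IH.
- by elim: n => [//|n IH] /=; apply: filterE => x; exact: IH.
- elim: n => [//|n IH] B C /= pB pC.
  by apply: filterS2 pB pC => x; exact: IH.
- by move=> B C; exact: tensor_powerS.
Qed.

Lemma tensor_power_ultra n B : tensor_power n B \/ tensor_power n (~` B).
Proof.
elim: n B => [|n IH] B /=; first exact: EM.
have [pB|pB] := in_ultra_setVsetC
    [set x | tensor_power n [set s | B (x :: s)]] pU; first by left.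
by right; apply: filterS pB => x /= nB; case: (IH [set s | B (x :: s)]).
Qed.

(** Erased coordinates become dummy quantifiers. *)
Lemma tensor_power_mask m B : tensor_power (count id m) B ->
  tensor_power (size m) [set s | B (mask m s)].
Proof.
elim: m B => [//|[] m IH] B /=.
- by apply: filterS => x /IH; exact: tensor_powerS.
- by move=> /IH nB; apply: filterE => x; apply: tensor_powerS nB.
Qed.

Lemma tensor_power_size n : tensor_power n [set s | size s = n].
Proof.
elim: n => [//|n IH] /=; apply: filterE => x.
by apply: tensor_powerS IH => s /= ->.
Qed.

Lemma tensor_power_gt k n : tensor_power n [set s | all (ltn k) s].
Proof.
elim: n => [//|n IH] /=; have : p [set x | k < x] by apply: poo; exists k.+1.
by apply: filterS => x /= kx; apply: tensor_powerS IH => s /= ->; rewrite kx.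
Qed.

Lemma tensor_power_sorted n : tensor_power n [set s | sorted ltn s].
Proof.
elim: n => [//|n IH] /=; apply: filterE => x.
apply: filterS2 IH (tensor_power_gt x n) => s /= ss xs.
by rewrite (path_sortedE ltn_trans) ss andbT.
Qed.

Definition code (x y : nat) : nat := pickle (x, y).

Lemma code_inj x y x' y' : code x y = code x' y' -> x = x' /\ y = y'.
Proof. by move=> /(pcan_inj pickleK) []. Qed.

Fixpoint pair_up (s : seq nat) : seq nat :=
  if s is x :: y :: s' then code x y :: pair_up s' else [::].

Fixpoint zip_code (s t : seq nat) : seq nat :=
  match s, t with
  | x :: s', y :: t' => code x y :: zip_code s' t'
  | _, _ => [::]
  end.

(* For n = 2 and s0 < s1 < s2 < s3 these are the codes of (s0, s1), (s2, s3),
   respectively of (s0, s2), (s1, s3). *)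
Definition separated_type n : set_system (seq nat) :=
  fun B => tensor_power n.*2 [set s | B (pair_up s)].

Definition crossing_type n : set_system (seq nat) :=
  fun B => tensor_power (n + n) [set s | B (zip_code (take n s) (drop n s))].

Lemma size_pair_up n s : size s = n.*2 -> size (pair_up s) = n.
Proof. by elim: n s => [|n IH] [|x [|y s]] //= [/IH ->]. Qed.

Lemma mem_pair_up c s : c \in pair_up s -> exists2 x, x \in s & exists y, c = code x y.
Proof.
have [k ks] := ubnP (size s); elim: k s ks => [//|k IH] [|x [|y s]] //= ks.
rewrite inE => /predU1P[->|cs]; first by exists x; [exact: mem_head|exists y].
have [|x' x's [y' ->]] := IH s _ cs; first by rewrite !ltnS in ks *; apply: leq_trans ks.
by exists x'; [rewrite !inE x's !orbT|exists y'].
Qed.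

Lemma pair_up_uniq s : uniq s -> uniq (pair_up s).
Proof.
have [k ks] := ubnP (size s); elim: k s ks => [//|k IH] [|x [|y s]] //= ks.
move=> /and3P[xs ys us]; apply/andP; split; last first.
  by apply: IH us; rewrite !ltnS in ks *; apply: leq_trans ks.
apply/negP => /mem_pair_up[x' x's [y' /code_inj[xx' _]]].
by rewrite inE xx' x's orbT in xs.
Qed.

Lemma pair_up_mask m s : size s = (size m).*2 ->
  pair_up (mask (flatten [seq [:: b; b] | b <- m]) s) = mask m (pair_up s).
Proof.
elim: m s => [|b m IH] [|x [|y s]] //= [/IH <-].
by case: b.
Qed.

Lemma size_zip_code s t : size s = size t -> size (zip_code s t) = size s.
Proof. by elim: s t => [|x s IH] [|y t] //= [/IH ->]. Qed.

Lemma zip_code_uniq s t : uniq s -> uniq (zip_code s t).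
Proof.
elim: s t => [|x s IH] [|y t] //= /andP[xs us]; rewrite IH// andbT.
apply: contra xs; elim: s t {IH us} => [|x' s IH] [|y' t] //=.
rewrite !inE => /predU1P[/code_inj[-> _]|/IH ->]; first by rewrite eqxx.
by rewrite orbT.
Qed.

Lemma zip_code_mask m s t :
  zip_code (mask m s) (mask m t) = mask m (zip_code s t).
Proof.
elim: m s t => [|b m IH] [|x s] [|y t]; rewrite ?mask0 //=.
- by case: b; case: (mask m s).
- by case: b; rewrite /= IH.
Qed.

(** Erasing a pair erases two adjacent entries, so each bit of the mask is doubled. *)
Lemma separated_coherent : coherent_type separated_type.
Proof.
split=> [n|n B|n|m B].
- split; [|split].
  + exact: (@filter_not_empty _ (tensor_power n.*2)).
  + by apply: filterE.
  + by move=> B C; exact: filterI.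
  + by move=> B C BC; apply: filterS => s; exact: BC.
- exact: tensor_power_ultra.
- apply: filterS2 (tensor_power_size n.*2) (tensor_power_sorted n.*2).
  move=> s /= ss so; split; first exact: size_pair_up.
  exact/pair_up_uniq/(sorted_uniq ltn_trans ltnn).
- rewrite /separated_type; pose m2 := flatten [seq [:: b; b] | b <- m].
  have -> : (count id m).*2 = count id m2.
    by rewrite /m2; elim: m {m2} => //= b m <-; rewrite doubleD -addnn addnA.
  have sm2 : size m2 = (size m).*2.
    by rewrite /m2; elim: m {m2} => //= b m ->.
  move=> /tensor_power_mask; rewrite sm2 => mB.
  apply: filterS2 mB (tensor_power_size (size m).*2) => s /= + ss.
  by rewrite pair_up_mask.
Qed.

(** Erasing a pair erases one entry at the same place in each half, so the mask is [m ++ m]. *)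
Lemma crossing_coherent : coherent_type crossing_type.
Proof.
split=> [n|n B|n|m B].
- split; [|split].
  + exact: (@filter_not_empty _ (tensor_power (n + n))).
  + by apply: filterE.
  + by move=> B C; exact: filterI.
  + by move=> B C BC; apply: filterS => s; exact: BC.
- exact: tensor_power_ultra.
- apply: filterS2 (tensor_power_size (n + n)) (tensor_power_sorted (n + n)).
  move=> s /= ss so; split.
    by rewrite size_zip_code ?size_takel ?size_drop ?ss ?addnK ?leq_addr.
  exact/zip_code_uniq/take_uniq/(sorted_uniq ltn_trans ltnn).
- rewrite /crossing_type -count_cat => /tensor_power_mask; rewrite size_cat => mB.
  apply: filterS2 mB (tensor_power_size (size m + size m)) => s /= + ss.
  rewrite -{1 2}(cat_take_drop (size m) s) mask_cat ?size_takel ?ss ?leq_addr//.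
  have szt : size (mask m (take (size m) s)) = count id m.
    by rewrite size_mask// size_takel// ss leq_addr.
  by rewrite take_cat drop_cat szt ltnn subnn take0 drop0 cats0 zip_code_mask.
Qed.

Definition pair_set (r : rel nat) : set (seq nat) :=
  [set s | r (nth 0 s 0) (nth 0 s 1)].

(* Write an element of the six-fold tensor power as s0 < ... < s5. If the
   disjoint pair s0 s2 is below s3 s5 and crossing pairs are ordered the other
   way, then s3 s5 < s1 s4 < s0 s2 < s3 s5. *)
Lemma separated_crossing_flip (r : rel nat) : irreflexive r -> transitive r ->
  separated_type 2 (pair_set r) -> ~ crossing_type 2 (pair_set [rel x y | r y x]).
Proof.
move=> rirr rtr sr nr.
have h1 : tensor_power 6 _ :=
  @tensor_power_mask [:: true; false; true; true; false; true] _ sr.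
have h2 : tensor_power 6 _ :=
  @tensor_power_mask [:: true; true; true; false; true; false] _ nr.
have h3 : tensor_power 6 _ :=
  @tensor_power_mask [:: false; true; false; true; true; true] _ nr.
have : tensor_power 6 [set s | size s = 6] by exact: tensor_power_size.
move=> /(filterI (filterI (filterI h1 h2) h3)) /filter_ex [s []].
case: s => [|s0 [|s1 [|s2 [|s3 [|s4 [|s5 [|s6 s]]]]]]] [[]] //.
rewrite /pair_set /= => r1 r2 r3 _.
by have := rtr _ _ _ (rtr _ _ _ r1 r3) r2; rewrite rirr.
Qed.

(** Almost every pair has distinct entries, which [r] orders one way or the other. *)
Lemma coherent_flip tau (r : rel nat) : coherent_type tau -> strict_linear r ->
  ~ tau 2 (pair_set [rel x y | r y x]) -> tau 2 (pair_set r).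
Proof.
move=> tauC [_ _ rtot] nr; have tF := coherent_proper tauC 2.
have [//|nr'] := coherent_ultra tauC 2 (pair_set [rel x y | r y x]).
apply: filterS2 nr' (coherent_uniq tauC 2) => -[|x [|y [|z s]]] nyx [] //= _.
rewrite inE andbT /pair_set /= => xy.
by case/orP: (rtot _ _ xy).
Qed.

Lemma separated_crossing_agree (r : rel nat) : strict_linear r ->
  separated_type 2 (pair_set r) <-> crossing_type 2 (pair_set r).
Proof.
move=> rL; have [rirr rtr _] := rL; split=> h.
  apply: (coherent_flip crossing_coherent) => //.
  exact: separated_crossing_flip h.
apply: (coherent_flip separated_coherent) => // h'.
(* The previous argument is applied to the converse order, whose converse is [r]. *)
apply: (@separated_crossing_flip [rel x y | r y x]) h' h => //.
by move=> y x z /= yx zy; exact: rtr yx.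
Qed.

(** On codes of increasing pairs, seen as intervals, this is the interval order. It is not linear,
    so it can tell the two types apart. *)
Definition before : rel nat := fun i j =>
  match unpickle i : option (nat * nat), unpickle j : option (nat * nat) with
  | Some (_, y), Some (x', _) => y < x' | _, _ => false
  end.

Lemma before_code x y x' y' : before (code x y) (code x' y') = (y < x').
Proof. by rewrite /before /code !pickleK. Qed.

Lemma separated_before : separated_type 2 (pair_set before).
Proof.
apply: filterS2 (tensor_power_size 4) (tensor_power_sorted 4).
move=> [|s0 [|s1 [|s2 [|s3 [|]]]]] //= _ /and4P[_ lt12 _ _].
by rewrite /pair_set /= before_code.
Qed.

Lemma crossing_before : crossing_type 2 (~` pair_set before).
Proof.
apply: filterS2 (tensor_power_size 4) (tensor_power_sorted 4).
move=> [|s0 [|s1 [|s2 [|s3 [|]]]]] //= _ /and4P[_ lt12 _ _].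
by rewrite /pair_set /= before_code; apply/negP; rewrite -leqNgt ltnW.
Qed.

End TensorPower.

(** * Minimal flows and retractions of the greatest ambit *)

Section GreatestAmbit.
Variables (X : topologicalType) (a : X -> Sinf -> X) (x0 : X).
Hypothesis aA : greatest_ambit a x0.

Let aG : G_flow a. Proof. by case: aA => -[]. Qed.
Let aF : is_flow a. Proof. by case: aG. Qed.
Let cX : compact [set: X]. Proof. by case: aG. Qed.
Let hX : hausdorff_space X. Proof. by case: aG. Qed.

Lemma orbit_dense (w : X) V : nbhs w V -> exists g, V (a x0 g).
Proof.
have : closure (range (a x0)) w by case: aA => -[_ ->].
by move=> clw /clw[_ [[g _ <-] Vg]]; exists g.
Qed.

Lemma equivariant_unique (f f' : X -> X) : continuous f -> continuous f' ->
  equivariant a a f -> equivariant a a f' -> f x0 = f' x0 -> f =1 f'.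
Proof.
move=> fC f'C fE f'E f0 w; apply: hX => A B nA nB.
have {}nA : nbhs w (f @^-1` A) by exact: fC.
have {}nB : nbhs w (f' @^-1` B) by exact: f'C.
have [g [/= Ag Bg]] := orbit_dense (filterI nA nB).
by exists (f (a x0 g)); split=> //; rewrite fE f0 -f'E.
Qed.

Lemma equivariant_orbit (f : X -> X) (M : set X) : continuous f ->
  equivariant a a f -> subflow a M -> M (f x0) -> forall w, M (f w).
Proof.
move=> fC fE [_ clM Minv] Mf w; apply: clM => U /fC /orbit_dense[g Ug].
by exists (f (a x0 g)); split=> //; rewrite fE; exact: Minv.
Qed.

(** This is [r w]: the action on relations, extended from the group to all points [w]. *)
Definition rel_map (r : rel nat) : X -> rel nat :=
  projT1 (cid (greatest_ambit_rel r aA)).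

Lemma near_rel_map r x i j :
  \forall x' \near x, rel_map r x' i j = rel_map r x i j.
Proof. by rewrite /rel_map; case: cid => pi [] /=. Qed.

Lemma rel_map_act r x (g : Sinf) i j :
  rel_map r (a x g) i j = rel_map r x (g @@ i) (g @@ j).
Proof. by rewrite /rel_map; case: cid => pi [] /=. Qed.

Lemma rel_map_base r : rel_map r x0 = r.
Proof. by rewrite /rel_map; case: cid => pi [] /=. Qed.

Lemma rel_map_orbit r (g : Sinf) i j : rel_map r (a x0 g) i j = r (g @@ i) (g @@ j).
Proof. by rewrite rel_map_act rel_map_base. Qed.

Lemma strict_linear_act r (g : Sinf) : strict_linear r ->
  strict_linear (fun i j => r (g @@ i) (g @@ j)).
Proof.
move=> [rirr rtr rtot]; split=> [i|y x z|i j ij]; [exact: rirr|exact: rtr|].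
by apply: rtot; apply: contra_neq ij; exact: (bij_inj (proj2_sig g)).
Qed.

(** Each axiom involves finitely many locally constant values, so [w] may be replaced by a point of
    the dense orbit. *)
Lemma rel_map_linear r w : strict_linear r -> strict_linear (rel_map r w).
Proof.
move=> rL; split=> [i|y x z|i j ij].
- have [g <-] := orbit_dense (near_rel_map r w i i).
  by rewrite rel_map_orbit; case: rL.
- have [g [[<- <-] <-]] := orbit_dense (filterI (filterI (near_rel_map r w x y)
    (near_rel_map r w y z)) (near_rel_map r w x z)).
  rewrite !rel_map_orbit; case: rL => _ rtr _; exact: rtr.
- have [g [<- <-]] :=
    orbit_dense (filterI (near_rel_map r w i j) (near_rel_map r w j i)).
  by rewrite !rel_map_orbit; case: (strict_linear_act g rL) => _ _; exact.
Qed.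

Lemma near_rel_map_sorted r w L : sorted (rel_map r w) L ->
  \forall w' \near w, sorted (rel_map r w') L.
Proof.
case: L => [|x L] /=; first by move=> _; exact: filterE.
elim: L x => [|y L IH] x /=; first by move=> _; exact: filterE.
move=> /andP[xy /IH nL]; apply: filterS2 (near_rel_map r w x y) nL.
by move=> w' /= -> ->; rewrite xy.
Qed.

(** * Limit points attached to linear orders *)

Section OrderLimit.
Variable tau : nat -> set_system (seq nat).
Hypothesis tauC : coherent_type tau.

(** The map [e]; the default [x0] is taken only where no limit exists, never at a strict linear
    order. *)
Definition order_limit (r : rel nat) : X :=
  xget x0 [set z : X | a x0 @ order_filter tau r --> z].

Lemma order_limit_cvg r : strict_linear r ->
  a x0 @ order_filter tau r --> order_limit r.
Proof.
move=> rL; have rP := order_filter_proper tauC rL.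
have [z cz] := flow_cvg aG x0 rP (order_filter_ultra tauC rL).
rewrite /order_limit; have [//|nz] := xgetP x0.
by have := nz z cz.
Qed.

(** Continuity of [e]: every order for which [L] is sorted has the same basic set in its filter, and
    its limit stays in the closed set [C]. *)
Lemma order_limit_near r W : strict_linear r -> nbhs (order_limit r) W ->
  exists2 L, sorted r L &
    forall r', strict_linear r' -> sorted r' L -> W (order_limit r').
Proof.
move=> rL /(closed_nbhs_sub aG)[C [nC clC CW]].
have [L sL tL] := order_limit_cvg rL nC.
exists L => // r' r'L sL'; apply/CW/clC => U nU.
have r'P := order_filter_proper tauC r'L.
have FC : order_filter tau r' [set g | C (a x0 g)] by exists L.
have [g [Cg Ug]] := filter_ex (filterI FC (order_limit_cvg r'L nU)).
by exists (a x0 g).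
Qed.

Lemma order_limit_act r (g : Sinf) : strict_linear r ->
  order_limit (fun i j => r (g @@ i) (g @@ j)) = a (order_limit r) g.
Proof.
move=> rL; have r'L := strict_linear_act g rL.
have r'P := order_filter_proper tauC r'L.
apply: (@cvg_unique _ hX _ (fmap_proper_filter (a x0) r'P)).
  exact: order_limit_cvg.
move=> W /(flow_continuous aF) /(order_limit_cvg rL)[L sL tL].
have [k [gk kg]] := sinf_inv g.
(* The inverse [k] of [g] carries lists sorted for [r] to lists sorted for the translated order. *)
exists [seq k @@ i | i <- L].
  rewrite sorted_map; apply: sub_sorted sL => i j /=.
  by rewrite !kg.
rewrite size_map.
have tP := coherent_proper tauC (size L).
apply: filterS tL => s /= sW h hs.
case: aF => _ aM _.
have -> : h = sinf_mul (sinf_mul h k) g by apply: sinf_ext => i /=; rewrite gk.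
by rewrite /= -aM; apply: sW; rewrite -hs -map_comp.
Qed.

(** Minimality of the image of [e]: a permutation can make any finite list sorted for a translate of
    [r']. *)
Lemma order_limit_transfer r r' W : strict_linear r -> strict_linear r' ->
  nbhs (order_limit r) W -> exists g, W (a (order_limit r') g).
Proof.
move=> rL r'L /(order_limit_near rL)[L sL LW].
have [L' sL' L'L] := strict_linear_sorted L r'L.
have [[rirr rtr _] [r'irr r'tr _]] := (rL, r'L).
have uL := sorted_uniq rtr rirr sL.
have uL' := sorted_uniq r'tr r'irr sL'.
have [|g gL] := @sinf_extension L L' uL uL'.
  by apply: perm_size; rewrite uniq_perm// => x; rewrite L'L.
exists g; rewrite -order_limit_act//; apply: LW; first exact: strict_linear_act.
have := sL'; rewrite -gL sorted_map; exact: sub_sorted.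
Qed.

(** Since [r i j], the values of [g] at [i] and [j] form a typical pair for [tau] along the
    filter. *)
Lemma order_limit_rel_map r r' i j b : strict_linear r -> r i j ->
  tau 2 [set s | r' (nth 0 s 0) (nth 0 s 1) = b] ->
  rel_map r' (order_limit r) i j = b.
Proof.
move=> rL rij tb; have rP := order_filter_proper tauC rL.
have Fb : order_filter tau r [set g | r' (g @@ i) (g @@ j) = b].
  exists [:: i; j]; first by rewrite /= rij.
  have tP := coherent_proper tauC 2.
  by apply: filterS tb => s /= + g gs; rewrite -gs.
have [g [gb <-]] :=
  filter_ex (filterI Fb (order_limit_cvg rL (near_rel_map r' (order_limit r) i j))).
by rewrite rel_map_orbit.
Qed.

(** * The smallest ideal and retractions *)

Section Multiplication.
Variable mul : X -> X -> X.
Hypothesis mulP : samuel_mul a x0 mul.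

Let mulC x : continuous (mul x). Proof. by case: (mulP x). Qed.
Let mulE x : equivariant a a (mul x). Proof. by case: (mulP x). Qed.
Let mul_base x : mul x x0 = x. Proof. by case: (mulP x). Qed.

Lemma mulA x y z : mul (mul x y) z = mul x (mul y z).
Proof.
apply: (equivariant_unique (f' := mul x \o mul y)) => //= [w|w g|].
- by apply: continuous_comp; exact: mulC.
- by rewrite /= !mulE.
- by rewrite /= !mul_base.
Qed.

Lemma closed_range_mul x : closed (range (mul x)).
Proof.
apply: (compact_closed hX); apply: continuous_compact cX.
by apply: continuous_subspaceT; exact: mulC.
Qed.

(** Both sides are continuous and equivariant in [w] and agree at [x0]; on the right, sortedness of
    a finite list is an open condition on [w]. *)
Lemma mul_order_limit r w : strict_linear r ->
  mul (order_limit r) w = order_limit (rel_map r w).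
Proof.
move=> rL; apply: (equivariant_unique (f' := order_limit \o rel_map r)) w => //=.
- move=> w W /(order_limit_near (rel_map_linear w rL))[L sL LW].
  apply: filterS (near_rel_map_sorted sL) => w' sL'.
  by apply: LW => //; exact: rel_map_linear.
- move=> w g /=; rewrite -order_limit_act; last exact: rel_map_linear.
  by congr order_limit; apply/funext => i; apply/funext => j; rewrite rel_map_act.
- by rewrite /= mul_base rel_map_base.
Qed.

Lemma order_limit_in_K r : strict_linear r -> in_K mul (order_limit r).
Proof.
move=> rL I [[w Iw] II]; set z := order_limit r.
have [_ Izw] := II _ z Iw.
(* By minimality [z] returns to the orbit closure of [mul z w], that is, to the right ideal it
   generates inside [I]. *)
have [q _ <-] : range (mul (mul z w)) z; last by case: (II _ q Izw).
apply: closed_range_mul => W /(order_limit_transfer rL (rel_map_linear w rL))[g Wg].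
exists (a (mul z w) g); split; last by rewrite /z mul_order_limit.
by exists (a x0 g) => //; rewrite mulE mul_base.
Qed.

(* Left multiplication by a point v of M maps the orbit closure of an order
   limit onto a subflow of M, hence onto M. *)
Lemma minimal_subflow_order_limit r M u : strict_linear r ->
  minimal_subflow a M -> M u ->
  exists v s, strict_linear s /\ u = mul v (order_limit s).
Proof.
move=> rL [Mf Mmin] Mu; pose z := order_limit r.
have [[v Mv] clM Minv] := Mf.
have uz : range (mul (mul v z)) u.
  rewrite (Mmin (range (mul (mul v z)))) //; first split.
  - by exists (mul (mul v z) x0), x0.
  - exact: closed_range_mul.
  - by move=> _ g [w _ <-]; exists (a w g) => //; rewrite mulE.
  - move=> _ [w _ <-]; rewrite mulA.
    by apply: (equivariant_orbit (@mulC v) (@mulE v) Mf); rewrite mul_base.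
have [w _ <-] := uz.
exists v, (rel_map r w); split; first exact: rel_map_linear.
by rewrite mulA mul_order_limit.
Qed.

Lemma retractionE M phi : retraction a M phi -> phi =1 mul (phi x0).
Proof.
by move=> [phiC phiE _ _]; apply: equivariant_unique.
Qed.

Lemma retraction_rel_map r M phi x y : strict_linear r ->
  minimal_subflow a M -> retraction a M phi ->
  (forall s, strict_linear s -> rel_map s x = rel_map s y) -> phi x = phi y.
Proof.
move=> rL Mm phiR xy; rewrite (retractionE phiR x) (retractionE phiR y).
have Mphi : M (phi x0) by case: phiR.
have [v [s [sL ->]]] := minimal_subflow_order_limit rL Mm Mphi.
by rewrite !mulA !mul_order_limit// xy.
Qed.

End Multiplication.
End OrderLimit.
End GreatestAmbit.

(** * The two points and their comparison *)

Lemma strict_linear_ltn : strict_linear ltn.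
Proof.
split=> [i|y x z|i j]; [exact: ltnn|exact: ltn_trans|by rewrite neq_ltn].
Qed.

Lemma strict_linear_ext (r r' : rel nat) : strict_linear r -> strict_linear r' ->
  (forall i j, i < j -> r i j = r' i j) -> r = r'.
Proof.
have flip (s : rel nat) i j : strict_linear s -> j < i -> s i j = ~~ s j i.
  move=> [sirr str stot] ji; have := stot i j; rewrite (gtn_eqF ji) => /(_ isT).
  have := str j i i; case: (s j i); case: (s i j) => //= /(_ isT isT).
  by rewrite sirr.
move=> rL r'L rr'; apply/funext => i; apply/funext => j.
have [ij|ji|->] := ltngtP i j; first exact: rr'.
  by rewrite (flip r)// (flip r')// rr'.
by case: rL r'L => rirr _ _ [r'irr _ _]; rewrite rirr r'irr.
Qed.

Theorem mainTheorem2 (X : topologicalType) (a : X -> Sinf -> X) (x0 : X)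
  (mul : X -> X -> X) :
  greatest_ambit a x0 -> samuel_mul a x0 mul ->
  exists x y : X, [/\ x <> y, in_K mul x, in_K mul y &
    forall M : set X, minimal_subflow a M ->
      forall phi : X -> X, retraction a M phi -> phi x = phi y].
Proof.
move=> aA mulP.
(* A nonprincipal ultrafilter. *)
have [p [pU poo]] := @ultraFilterLemma nat \oo _.
have sC := separated_coherent pU poo; have nC := crossing_coherent pU poo.
have ltnL := strict_linear_ltn.
exists (order_limit a x0 (separated_type p) ltn).
exists (order_limit a x0 (crossing_type p) ltn).
split; [|exact: (order_limit_in_K aA sC)|exact: (order_limit_in_K aA nC)|].
(* The relation [before], read at the coordinates 0 and 1, separates the points. *)
- have sb := order_limit_rel_map aA sC ltnL (isT : ltn 0 1)
    (separated_before pU poo : separated_type p 2 [set s | _ = true]).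
  have nb : rel_map aA before (order_limit a x0 (crossing_type p) ltn) 0 1 = false.
    apply: (order_limit_rel_map aA nC ltnL) => //.
    have nP := coherent_proper nC 2.
    by apply: filterS (crossing_before pU poo) => s /negP/negbTE.
  by move=> xy; rewrite xy nb in sb.
- move=> M Mm phi phiR; apply: (retraction_rel_map sC mulP ltnL Mm phiR) => s sL.
  apply: strict_linear_ext; [exact: rel_map_linear|exact: rel_map_linear|].
  move=> i j ij; have [sP nP] := (coherent_proper sC 2, coherent_proper nC 2).
  have [h|h] := coherent_ultra sC 2 (pair_set s).
    rewrite (order_limit_rel_map aA sC (b := true) ltnL)// .
    rewrite (order_limit_rel_map aA nC (b := true) ltnL)// .
    exact/(separated_crossing_agree pU poo).
  (* The mixed case is excluded, as linear orders do not distinguish the two types. *)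
  have [h'|h'] := coherent_ultra nC 2 (pair_set s).
    have /(filterI h)/filter_ex[t []//] : separated_type p 2 (pair_set s).
    exact/(separated_crossing_agree pU poo).
  rewrite (order_limit_rel_map aA sC (b := false) ltnL)//; last first.
    by apply: filterS h => t /negP/negbTE.
  rewrite (order_limit_rel_map aA nC (b := false) ltnL)// .
  by apply: filterS h' => t /negP/negbTE.
Qed.
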